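(* Let $(X,d)$ be an unbounded metric space. For a subset $Y$ of $X$ and a natural number $n\geqslant 1$, the following statements are equivalent: (i) $Y$ is $n$-thin; (ii) $Y$ can be partitioned into $\leqslant n$ thin subsets; (iii) $|\bigtriangleup_p(Y)|\leqslant n$ for each $p\in X^\#$.
   Context: For $x\in X$, $r\geqslant 0$, $A\subseteq X$: $B(x,r)=\{y\in X: d(x,y)\leqslant r\}$ and $B(A,r)=\bigcup_{a\in A}B(a,r)$. A subset $V\subseteq X$ is bounded if $V\subseteq B(x,r)$ for some $x\in X$, $r\geqslant 0$. A subset $Y\subseteq X$ is thin if for each $r\geqslant 0$ there exists a bounded subset $V$ of $X$ such that $B(y,r)\cap Y=\{y\}$ for each $y\in Y\setminus V$. A subset $Y\subseteq X$ is $n$-thin if for each $r\geqslant 0$ there exists a bounded subset $V$ of $X$ such that $|B(y,r)\cap Y|\leqslant n$ for each $y\in Y\setminus V$ (so thin means $1$-thin). $\beta X$ denotes the set of all ultrafilters on $X$ (the Stone-Čech compactification of $X$ with the discrete topology). For $Y\subseteq X$, $Y^\#=\{p\in\beta X: Y\in p \text{ and each } P\in p \text{ is unbounded in } X\}$; in particular $X^\#$ is the set of all ultrafilters on $X$ all of whose members are unbounded. For $p,q\in X^\#$ write $p\parallel q$ if there is $r\geqslant 0$ such that $B(Q,r)\in p$ for each $Q\in q$ (this is an equivalence relation, called parallel equivalence). Put $\overline{\overline{p}}=\{q\in X^\#: p\parallel q\}$ and, for $Y\subseteq X$, $\bigtriangleup_p(Y)=\overline{\overline{p}}\cap Y^\#$.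 *)

(* Defs.v *)
From HB Require Import structures.
From mathcomp Require Import all_boot all_order all_algebra.
From mathcomp Require Import boolp classical_sets functions cardinality filter.
From mathcomp Require Import reals topology.

Set Implicit Arguments.
Unset Strict Implicit.
Unset Printing Implicit Defensive.

Import Order.TTheory GRing.Theory Num.Theory.

Local Open Scope classical_set_scope.
Local Open Scope ring_scope.
Local Open Scope card_scope.

Section Definitions.
Context {R : realType} {X : metricType R}.

(* The library's [closed_ball x r] is the closure of the open ball, which may
   be strictly smaller than B(x, r), so B(x, r) is written out here. *)
Definition mball (x : X) (r : R) : set X := [set y | mdist x y <= r].

Definition mball_set (A : set X) (r : R) : set X := \bigcup_(a in A) mball a r.

(* The centre x is required to exist, so on an empty space no set, not even the
   empty one, is bounded. *)
Definition mbounded (V : set X) : Prop :=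
  exists x : X, exists2 r : R, 0 <= r & V `<=` mball x r.

Definition thin (Y : set X) : Prop :=
  forall r : R, 0 <= r -> exists2 V : set X, mbounded V &
    forall y, (Y `\` V) y -> mball y r `&` Y = [set y].

(* [A #<= `I_n] says that A is finite with at most n elements. *)
Definition nthin (n : nat) (Y : set X) : Prop :=
  forall r : R, 0 <= r -> exists2 V : set X, mbounded V &
    forall y, (Y `\` V) y -> mball y r `&` Y #<= `I_n.

(* The elements of a partition are nonempty; the empty set has the empty
   partition. *)
Definition thin_partitionable (n : nat) (Y : set X) : Prop :=
  exists P : set (set X),
    [/\ classical_sets.partition P id Y, P #<= `I_n & P `<=` thin].

(* Y^#; the points of the Stone-Cech compactification of the discrete space X
   are the ultrafilters on X. *)
Definition sharp (Y : set X) : set (set_system X) :=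
  [set p | [/\ UltraFilter p, p Y & forall P, p P -> ~ mbounded P]].

Definition parallel (p q : set_system X) : Prop :=
  exists2 r : R, 0 <= r & forall Q, q Q -> p (mball_set Q r).

Definition parallel_class (p : set_system X) : set (set_system X) :=
  [set q | sharp setT q /\ parallel p q].

Definition delta (p : set_system X) (Y : set X) : set (set_system X) :=
  parallel_class p `&` sharp Y.

End Definitions.

(* Main.v *)
(* (i) => (ii): join points of Y that are close relative to their distance from
   a base point; n-thinness bounds the closed neighbourhoods of this graph by n,
   so it splits into n independent sets, and independent sets are thin.
   (ii) => (iii): parallel ultrafilters containing the same thin set coincide.
   (iii) => (i): if Y is not n-thin, an unbounded separated set of points whose
   balls contain n + 1 points of Y carries an ultrafilter p with unbounded
   members; moving each point to its i-th neighbour in Y pushes p to n + 1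
   distinct elements of delta p Y. *)
Require Import Defs.
From mathcomp Require Import all_boot all_order all_algebra.
From mathcomp Require Import boolp classical_sets functions cardinality filter.
From mathcomp Require Import reals topology.
From mathcomp Require Import zify lra.

Local Open Scope classical_set_scope.
Local Open Scope ring_scope.
Local Open Scope card_scope.

Import Order.TTheory GRing.Theory Num.Theory.

(** * Cardinality bounds through injections *)

Lemma card_le_I_inj (T : Type) (A : set T) (n : nat) :
  A #<= `I_n <-> exists2 f : T -> nat, (forall x, A x -> (f x < n)%N) &
    forall x y, A x -> A y -> f x = f y -> x = y.
Proof.
split=> [/pcard_leP/injfunPex[f fA f_inj]|[f fA f_inj]].
  by exists f => // x y Ax Ay; apply: f_inj; rewrite inE.
by apply/pcard_leP/injfunPex; exists f => // x y; rewrite !inE; apply: f_inj.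
Qed.

(** The element with value [n], if any, takes over [f z], the value freed by removing [z]. *)
Lemma card_le_I_setD1 (T : Type) (A : set T) (z : T) (n : nat) :
  A z -> A #<= `I_n.+1 -> A `\ z #<= `I_n.
Proof.
move=> Az /card_le_I_inj[f fn f_inj]; apply/card_le_I_inj.
exists (fun x => if f x == n then f z else f x) => [x [Ax xz]|x y [Ax xz] [Ay yz]].
  have fxz : f x != f z by apply/eqP => /(f_inj _ _ Ax Az).
  have [fxn|fxn] := eqVneq (f x) n; have := fn x Ax; have := fn z Az; lia.
have [fxn|fxn] := eqVneq (f x) n; have [fyn|fyn] := eqVneq (f y) n.
- by move=> _; apply: f_inj => //; rewrite fxn.
- by move=> /(f_inj _ _ Az Ay) /esym.
- by move=> /(f_inj _ _ Ax Az).
- exact: f_inj.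
Qed.

Lemma card_le_I_setU1 (T : Type) (A : set T) (z : T) (n : nat) :
  A #<= `I_n -> z |` A #<= `I_n.+1.
Proof.
move=> /card_le_I_inj[f fn f_inj]; apply/card_le_I_inj.
exists (fun x => if `[< x = z >] then n else f x).
  by move=> x [->|Ax]; case: asboolP => // _; apply/ltnW; rewrite ltnS fn.
move=> x y xA yA; case: asboolP => [->|xz]; case: asboolP => [->|yz] //.
- by case: yA => // Ay nf; move: (fn _ Ay); rewrite -nf ltnn.
- by case: xA => // Ax nf; move: (fn _ Ax); rewrite nf ltnn.
- by case: xA => // Ax; case: yA => // Ay; apply: f_inj.
Qed.

(** Either [A] is finite, so that sizes compare, or it contains a copy of [nat]; in both cases it
    surjects onto the first [n.+1] naturals, and [f] chooses preimages. *)
Lemma card_gt_I_inj (T : Type) (A : set T) (n : nat) :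
  ~ (A #<= `I_n) -> exists2 f : nat -> T, (forall i, (i <= n)%N -> A (f i)) &
    forall i j, (i <= n)%N -> (j <= n)%N -> f i = f j -> i = j.
Proof.
move=> An; have : `I_n.+1 #<= A.
  have [[m Am]|/infiniteP] := pselect (finite_set A); last first.
    exact: card_le_trans (subset_card_le _).
  rewrite (card_le_eqr Am) card_le_II ltnNge; apply/negP => mn; apply: An.
  by rewrite (card_le_eql Am) card_le_II.
move=> /pfcard_geP[I0|[g]].
  by have : set0 0%N by rewrite -I0 /=.
have g_surj : set_surj A `I_n.+1 g by apply: surj.
have [a0 _ _] := g_surj 0%N isT.
have /choice[f fP] : forall i, exists a, (i <= n)%N -> A a /\ g a = i.
  move=> i; have [le_in|] := leqP i n; last by exists a0.
  by have [a Aa ga] := g_surj i le_in; exists a.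
exists f => [i /fP[]//|i j /fP[_ gi] /fP[_ gj] fij].
by rewrite -gi -gj fij.
Qed.

(** * Independent sets in graphs *)

(** By Zorn's lemma: two points in the union of a chain lie in a common member, and a point with no
    neighbour in a maximal [M] could be added to it. *)
Lemma maximal_independent (T : Type) (e : T -> T -> Prop) (Y : set T) :
  (forall x, e x x) -> (forall x y, e x y -> e y x) ->
  exists M : set T, [/\ M `<=` Y,
    forall x y, M x -> M y -> e x y -> x = y &
    forall y, Y y -> exists2 z, M z & e y z].
Proof.
move=> e_refl e_sym.
pose indep M := M `<=` Y /\ forall x y, M x -> M y -> e x y -> x = y.
have [F F_indep F_total|M [[MY M_indep] M_max]] := @Zorn_bigcup T indep.
  split=> [x [A /F_indep[AY _]]|x y [A FA Ax] [B FB By]]; first exact: AY.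
  have [AB|BA] := F_total _ _ FA FB.
    by apply: (F_indep _ FB).2 => //; apply: AB.
  by apply: (F_indep _ FA).2 => //; apply: BA.
exists M; split=> // y Yy; apply: contrapT => no_nbr.
have My : ~ M y by move=> My; apply: no_nbr; exists y.
apply: (M_max (y |` M)).
  by split=> [x|/(_ y)]; [right | apply: contra_not My; apply; left].
split=> [x [->//|/MY//]|x z [->|Mx] [->|Mz]//] exz.
- by case: no_nbr; exists z.
- by case: no_nbr; exists x => //; apply: e_sym.
- exact: M_indep.
Qed.

(* Removing a maximal independent set lowers the size of every closed
   neighbourhood by at least one. *)
Lemma partition_independent (T : Type) (e : T -> T -> Prop) (Y : set T)
    (n : nat) :
  (forall x, e x x) -> (forall x y, e x y -> e y x) ->
  (forall y, Y y -> Y `&` e y #<= `I_n) ->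
  exists P : set (set T), [/\ classical_sets.partition P id Y, P #<= `I_n &
    forall A, P A -> forall x y, A x -> A y -> e x y -> x = y].
Proof.
move=> e_refl e_sym; elim: n Y => [|n IHn] Y degY.
  exists set0; split; [|exact: card_ge0|by []].
  split=> //; rewrite /cover bigcup_set0; apply/esym; rewrite -subset0 => y Yy.
  have /card_le_I_inj[f fn _] := degY y Yy.
  by have := fn y (conj Yy (e_refl y)).
(* Blocks must be nonempty, so the case where [M] would be empty is treated apart. *)
have [->|/set0P[y0 Yy0]] := eqVneq Y set0.
  exists set0; split; [|exact: card_ge0|by []].
  by split=> //; rewrite /cover bigcup_set0.
have [M [MY M_indep M_max]] := maximal_independent _ _ Y e_refl e_sym.
have [y [Yy My]|P [[P_cover P_triv P_neq0] Pn P_indep]] := IHn (Y `\` M).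
  have [z Mz eyz] := M_max y Yy.
  apply: card_le_trans (card_le_I_setD1 _ _ z _ _ (degY y Yy)); last first.
    by split=> //; apply: MY.
  apply: subset_card_le => x [[Yx Mx] eyx]; split=> // xz.
  by apply: Mx; rewrite xz.
have PM A : P A -> A `&` M = set0.
  move=> PA; rewrite -subset0 => x [Ax Mx].
  have : cover P id x by exists A.
  by rewrite P_cover => -[].
exists (M |` P); split.
- split.
  + rewrite /cover bigcup_setU1 /=; move: P_cover; rewrite /cover => ->.
    exact: setDUK.
  + move=> A B [->|PA] [->|PB]//= [x [Ax Bx]].
    * by have : set0 x by rewrite -(PM _ PB).
    * by have : set0 x by rewrite -(PM _ PA).
    * by apply: (P_triv A B) => //; exists x.
  + move=> A [->|/P_neq0//]; have [z Mz _] := M_max _ Yy0; by exists z.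
- exact: card_le_I_setU1.
- by move=> A [->//|/P_indep].
Qed.

(** * Ultrafilters *)

Lemma fmap_ultra (T U : Type) (f : T -> U) (F : set_system T) :
  UltraFilter F -> UltraFilter (fmap f F).
Proof.
move=> FU; split=> [|G GF FG]; first exact: fmap_proper_filter.
apply/seteqP; split=> // A GA.
have [//|FA] := in_ultra_setVsetC (f @^-1` A) FU.
by have [x []] := filter_ex (filterI GA (FG (~` A) FA)).
Qed.

(** Otherwise the complements of all members of [P] would belong to [F], and so would their finite
    intersection, which misses the cover. *)
Lemma ultra_cover_finite (T : Type) (F : set_system T) (P : set (set T))
    (n : nat) :
  UltraFilter F -> P #<= `I_n -> F (cover P id) -> exists2 A, P A & F A.
Proof.
move=> FU /card_le_I_inj[f fn f_inj] FP; apply: contrapT => noA.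
have FC m : F [set x | forall A, P A -> (f A < m)%N -> ~ A x].
  elim: m => [|m IHm]; first by apply: filterS filterT.
  have [[A [PA fA]]|no_m] := pselect (exists A, P A /\ f A = m).
    have FA : F (~` A).
      by have [FA|//] := in_ultra_setVsetC A FU; case: noA; exists A.
    apply: filterS (filterI IHm FA) => x [xm Ax] B PB.
    rewrite ltnS leq_eqVlt => /orP[/eqP fB|]; last exact: xm.
    by rewrite (f_inj B A) // fA.
  apply: filterS IHm => x xm B PB; rewrite ltnS leq_eqVlt => /orP[/eqP fB|].
    by case: no_m; exists B.
  exact: xm.
have [x [xn [A PA Ax]]] := filter_ex (filterI (FC n) FP).
exact: (xn A PA (fn A PA)).
Qed.

(** * Bounded sets, and thin partitions of n-thin sets *)

Section MetricLemmas.
Context {R : realType} {X : metricType R}.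
Implicit Types (x y z : X) (V W A Y : set X) (p q : set_system X) (r : R).

Lemma mbounded_center x0 V :
  mbounded V -> exists2 r, 0 <= r & V `<=` mball x0 r.
Proof.
move=> [x [r r0 Vr]]; exists (mdist x0 x + r); first by rewrite addr_ge0 ?mdist_ge0.
move=> y /Vr xy; rewrite /mball/=.
by apply: le_trans (metric_triangle _ x _) _; rewrite lerD2l.
Qed.

Lemma sub_mbounded V W : V `<=` W -> mbounded W -> mbounded V.
Proof. by move=> VW [x [r r0 Wr]]; exists x, r => // y /VW /Wr. Qed.

Lemma mbounded_mball_set V r : 0 <= r -> mbounded V -> mbounded (mball_set V r).
Proof.
move=> r0 [x [s s0 Vs]]; exists x, (s + r); first exact: addr_ge0.
move=> y [z /Vs xz zy]; rewrite /mball/=.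
by apply: le_trans (metric_triangle _ z _) _; apply: lerD.
Qed.

Lemma mbounded_setU V W : mbounded V -> mbounded W -> mbounded (V `|` W).
Proof.
move=> [x [r r0 Vr]] /(mbounded_center x)[s s0 Ws].
exists x, (r + s); first exact: addr_ge0.
by move=> y [/Vr|/Ws]; rewrite /mball/= => /le_trans; apply; rewrite ?lerDl ?lerDr.
Qed.

Lemma thinP A : thin A <-> forall r, 0 <= r -> exists2 V, mbounded V &
  forall x y, (A `\` V) x -> A y -> mdist x y <= r -> x = y.
Proof.
split=> thinA r r0; have [V bV AV] := thinA r r0; exists V => //.
  move=> x y AVx Ay xy; have : (mball x r `&` A) y by [].
  by rewrite AV // => ->.
move=> y AVy; apply/seteqP; split=> [z [yz Az]|z ->]/=.
  by apply/esym/AV.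
by split; [rewrite /mball/= mdistxx | case: AVy].
Qed.

(* The graph joins distinct points [y], [z] when [d(y, z) <= m] and both lie
   beyond the radius [rad m] from which on [m]-balls meet [Y] in at most [n]
   points. As [m <= rad m], a point sees finitely many [m], so its closed
   neighbourhood is contained in the ball for the largest of them. *)
Lemma nthin_partitionable x0 Y (n : nat) :
  (1 <= n)%N -> nthin n Y -> thin_partitionable n Y.
Proof.
move=> n1 Yn.
have /choice[rad radP] : forall m : nat, exists s : R, m%:R <= s /\
    forall y, Y y -> s < mdist x0 y -> mball y m%:R `&` Y #<= `I_n.
  move=> m; have [V /(mbounded_center x0)[s s0 Vs] YV] := Yn m%:R (ler0n _ _).
  (* The summand [s] keeps [y] outside [V]; the summand [m%:R] gives [m <= rad m]. *)
  exists (m%:R + s); split; first by rewrite lerDl.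
  move=> y Yy sy; apply: YV; split=> // /Vs; rewrite /mball/= => sy'.
  by move: (ler0n R m); lra.
pose far (m : nat) y := rad m < mdist x0 y.
pose e y z := y = z \/ exists m : nat, [/\ mdist y z <= m%:R, far m y & far m z].
have e_refl y : e y y by left.
have e_sym y z : e y z -> e z y.
  by move=> [->|[m [yz fy fz]]]; [left | right; exists m; rewrite metric_sym].
have [y Yy|P [P_part Pn P_indep]] := partition_independent _ e Y n e_refl e_sym.
  (* A point that is far for no [m] is isolated; its neighbourhood is a singleton, and [1 <= n]. *)
  have [ex_far|no_far] := pselect (exists m, far m y); last first.
    apply: (@card_le_trans _ _ _ [set y]); last first.
      by apply/card_le_I_inj; exists (fun=> 0%N) => // a b /= -> ->.
    by apply: subset_card_le => z [_ [->//|[m [_ fy _]]]]; case: no_far; exists m.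
  have {}ex_far : exists m, `[< far m y >] by case: ex_far => m /asboolP; exists m.
  have far_bnd m : `[< far m y >] -> (m <= Num.truncn (mdist x0 y))%N.
    move=> /asboolP fy; rewrite truncn_ge_nat ?mdist_ge0 //.
    exact: le_trans (radP m).1 (ltW fy).
  have [m /asboolP fy m_max] := ex_maxnP ex_far far_bnd.
  apply: card_le_trans ((radP m).2 y Yy fy).
  apply: subset_card_le => z [Yz eyz]; split=> //; rewrite /mball/=.
  case: eyz => [<-|[k [yz fky _]]]; first by rewrite mdistxx.
  by apply: le_trans yz _; rewrite ler_nat m_max //; apply/asboolP.
exists P; split=> // A /P_indep A_indep; apply/thinP => r r0.
pose m := (Num.truncn r).+1.
have rm : r <= m%:R by apply/ltW/truncnS_gt.
(* The extra [r] makes each [y] within [r] of [x] far for [m] as well. *)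
exists (mball x0 (rad m + r)).
  exists x0, (rad m + r) => //; apply: addr_ge0 => //.
  exact: le_trans (radP m).1.
move=> x y [Ax /negP]; rewrite -ltNge => fx Ay xy; apply: A_indep => //.
right; exists m; split; first exact: le_trans rm.
  by rewrite /far; lra.
rewrite /far; have := metric_triangle x0 y x; rewrite (metric_sym y x); lra.
Qed.

(** * Parallel ultrafilters on thin sets *)

(** If [Q] is in [q'] but not in [q], then [p] contains neighbourhoods of a part of [A] outside [Q]
    and of a part inside [Q]. These meet, giving points of [A] at distance at most [r + r'], which
    thinness identifies. *)
Lemma thin_parallel_unique A p q q' :
  ProperFilter p -> sharp A q -> sharp A q' -> thin A ->
  parallel p q -> parallel p q' -> q = q'.
Proof.
move=> pF [qU qA q_unb] [qU' qA' q_unb'] /thinP thinA [r r0 pq] [r' r0' pq'].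
have qD V B : mbounded V -> q B -> q (B `\` V).
  move=> bV qB; apply: filterI => //.
  by have [/q_unb|] := in_ultra_setVsetC V qU.
apply: (@max_filter _ _ qU').
move=> Q qQ'; have [//|qQ] := in_ultra_setVsetC Q qU.
have [V bV AV] := thinA (r + r') (addr_ge0 r0 r0').
have pQ : p (mball_set ((A `&` ~` Q) `\` V) r).
  by apply/pq/qD => //; apply: filterI.
have pQ' : p (mball_set (A `&` Q) r') by apply: pq'; apply: filterI.
have [x [[a [[Aa Qa] Va] ax] [b [Ab Qb] bx]]] := filter_ex (filterI pQ pQ').
case: Qa; rewrite (AV a b) //.
apply: le_trans (metric_triangle a x b) _.
by apply: lerD => //; rewrite metric_sym.
Qed.

(** Each ultrafilter in [delta p Y] contains a block of the partition, and that block determines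
    it. *)
Lemma partitionable_delta Y (n : nat) p :
  thin_partitionable n Y -> ProperFilter p -> delta p Y #<= `I_n.
Proof.
move=> [P [[P_cover _ _] Pn P_thin]] pF.
have /choice[c cP] : forall q, exists A, delta p Y q -> P A /\ q A.
  move=> q; have [[_ [qU qY _]]|] := pselect (delta p Y q); last by exists set0.
  have [A PA qA] : exists2 A, P A & q A.
    by apply: (ultra_cover_finite _ _ _ _ qU Pn); rewrite P_cover.
  by exists A.
move: Pn => /card_le_I_inj[f fn f_inj]; apply/card_le_I_inj.
exists (f \o c) => [q /cP[Pc _]|q q' dq dq']; first exact: fn.
have [[Pc qc] [Pc' qc']] := (cP q dq, cP q' dq').
move=> /(f_inj _ _ Pc Pc') cqq'.
have [[[_ pq] [qU _ q_unb]] [[_ pq'] [qU' _ q_unb']]] := (dq, dq').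
apply: (thin_parallel_unique (c q) p) => //; last exact: P_thin.
by split=> //; rewrite cqq'.
Qed.

(** * Ultrafilters witnessing failure of n-thinness *)

(** The complements in [S] of bounded sets form a base of a proper filter; an ultrafilter extending
    it has no bounded member. *)
Lemma unbounded_ultra (x0 : X) S : ~ mbounded S -> exists p, sharp S p.
Proof.
move=> S_unb.
have [|p [pU p_sub]] := @ultraFilterLemma _ (filter_from mbounded (fun V => S `\` V)).
  apply: filter_from_proper; last first.
    move=> V bV; apply/set0P/negP => /eqP; rewrite setD_eq0 => SV.
    by apply: S_unb; apply: sub_mbounded bV.
  apply: filter_from_filter.
    by exists [set x0], x0, 0 => // y ->; rewrite /mball/= mdistxx.
  move=> V W bV bW; exists (V `|` W); first exact: mbounded_setU.
  by move=> y [Sy VWy]; split; split=> // Vy; apply: VWy; [left | right].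
exists p; split=> // [|V pV bV].
  apply: p_sub; exists set0; last by move=> y [].
  by exists x0, 0.
have pSV : p (S `\` V) by apply: p_sub; exists V.
by have [y [Vy []]] := filter_ex (filterI pV pSV).
Qed.

(* On a [2r]-separated set [S], maps moving points by at most [r] and with
   distinct values at each point have disjoint images, hence push an
   ultrafilter on [S] to distinct ultrafilters. *)
Lemma delta_nthin (x0 : X) Y (n : nat) :
  (forall p, sharp setT p -> delta p Y #<= `I_n) -> nthin n Y.
Proof.
move=> Yn; apply: contrapT => /existsNP[r /not_implyP[r0 Y_fat]].
pose fat := [set y | Y y /\ ~ (mball y r `&` Y #<= `I_n)].
(* A bounded [fat] would itself serve as the exceptional set for [r]. *)
have fat_unb : ~ mbounded fat.
  move=> b_fat; apply: Y_fat; exists fat => // y [Yy y_thin].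
  by apply: contrapT => y_fat; apply: y_thin.
have [||S [S_fat S_sep S_max]] :=
  @maximal_independent X (fun x y => mdist x y <= r + r) fat.
- by move=> x; rewrite mdistxx addr_ge0.
- by move=> x y; rewrite metric_sym.
(* By maximality the balls of radius [r + r] around [S] cover [fat]. *)
have S_unb : ~ mbounded S.
  move=> /(mbounded_mball_set _ _ (addr_ge0 r0 r0)); apply: contra_not fat_unb.
  apply: sub_mbounded => y /S_max[z Sz yz]; exists z => //.
  by rewrite /mball/= metric_sym.
have [p [pU pS p_unb]] := unbounded_ultra x0 _ S_unb.
have pX : sharp setT p by split=> //; apply: filterT.
have /choice[f fP] : forall x, exists g : nat -> X, S x ->
    (forall i, (i <= n)%N -> (mball x r `&` Y) (g i)) /\
    forall i j, (i <= n)%N -> (j <= n)%N -> g i = g j -> i = j.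
  move=> x; have [/S_fat[_ /card_gt_I_inj[g g1 g2]]|] := pselect (S x).
    by exists g.
  by exists (fun=> x).
pose q i := fmap (f^~ i) p.
have qU i : UltraFilter (q i) by apply: fmap_ultra.
have q_delta i : (i <= n)%N -> delta p Y (q i).
  move=> le_in.
  (* Moving back by at most [r] gives both parallelism and unboundedness of the members of [q i]. *)
  have q_near Q : q i Q -> p (mball_set Q r).
    move=> qQ; have : p (S `&` f^~ i @^-1` Q) by apply: filterI.
    apply: filterS => x [Sx Qx].
    exists (f x i) => //; rewrite /mball/= metric_sym.
    by have [/(_ i le_in)[]] := fP x Sx.
  have q_unb Q : q i Q -> ~ mbounded Q.
    by move=> /q_near/p_unb; apply: contra_not => /(mbounded_mball_set _ _ r0).
  split; first by split; [split=> //; apply: filterT | exists r].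
  split=> //; change (p (f^~ i @^-1` Y)).
  apply: filterS pS => x Sx; rewrite /preimage/=.
  by have [/(_ i le_in)[]] := fP x Sx.
have q_inj i j : (i <= n)%N -> (j <= n)%N -> q i = q j -> i = j.
  move=> le_in le_jn qij.
  have q_image k : q k ((f^~ k) @` S).
    change (p (f^~ k @^-1` (f^~ k @` S))).
    by apply: filterS pS => x Sx; exists x.
  (* Equal ultrafilters force the two images of [S] to meet in some [z]; separation then makes both
     preimages of [z] the same point. *)
  have := q_image j; rewrite -qij => qj_image.
  have [z [[x Sx xz] [y Sy yz]]] := filter_ex (filterI (q_image i) qj_image).
  have [fx_near f_inj] := fP x Sx; have [fy_near _] := fP y Sy.
  have xy : x = y.
    apply: S_sep => //; apply: (le_trans (metric_triangle x z y)).
    have [+ _] := fx_near i le_in; have [+ _] := fy_near j le_jn.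
    by rewrite /mball/= xz yz => yz_r xz_r; rewrite lerD // metric_sym.
  by apply: f_inj => //; rewrite xz {1}xy yz.
suff : `I_n.+1 #<= `I_n by rewrite card_le_II ltnn.
apply: card_le_trans (Yn p pX).
have [g] : $|{injfun `I_n.+1 >-> delta p Y}|.
  by apply/injfunPex; exists q => // i j; rewrite !inE; apply: q_inj.
exact: inj_card_le g.
Qed.

End MetricLemmas.

Theorem theorem4p3 (R : realType) (X : metricType R)
  (X_nonempty : [set: X] !=set0) (X_unbounded : ~ mbounded [set: X])
  (Y : set X) (n : nat) (n_ge1 : (1 <= n)%N) :
  (nthin n Y <-> thin_partitionable n Y) /\
  (thin_partitionable n Y <->
    (forall p : set_system X, sharp [set: X] p -> delta p Y #<= `I_n)).
Proof.
have [x0 _] := X_nonempty.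
have i_ii : nthin n Y -> thin_partitionable n Y by apply: nthin_partitionable.
have ii_iii : thin_partitionable n Y ->
    forall p : set_system X, sharp [set: X] p -> delta p Y #<= `I_n.
  move=> YP p [pU _ _]; apply: partitionable_delta => //.
have iii_i := delta_nthin x0 Y n.
split; split; auto.
Qed.
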